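(* Let $X$ and $Y$ be pointed metric spaces, let $1\le s<p$ and $0<q\le s$. Then every Lipschitz map from $X$ to $Y$ is Lipschitz $(p,\mathfrak{m}^L(s;q))$-summing; more precisely $$\Pi_{(p,\mathfrak{m}^L(s;s))}^{L}(X,Y)=\mathbb{L}(X,Y)=\Pi_{(p,\mathfrak{m}^L(s;q))}^{L}(X,Y).$$
   Context: $\mathbb{L}(X,Y)$ is the set of all Lipschitz maps $X\to Y$. For a metric space $X$ with base point $x_0$, $X^{\#}$ is the Banach space of real-valued Lipschitz functions on $X$ vanishing at $x_0$, with norm $Lip(\cdot)$ (the Lipschitz constant); $B_{X^{\#}}$ is its closed unit ball. $(\sigma,x',x'')$ denotes a finite sequence $(\sigma_j,x'_j,x''_j)_{j=1}^m$ in $\mathbb{R}\times X\times X$. Indices lie in $(0,\infty]$, $1/\infty=0$. Put $\|(\sigma,x',x'')|\ell_p\|=\big[\sum_j|\sigma_j|^p d_X(x'_j,x''_j)^p\big]^{1/p}$ and $\|(\sigma,x',x'')|\ell_p^{L,w}\|=\sup_{f\in B_{X^{\#}}}\big[\sum_j|\sigma_j|^p|f(x'_j)-f(x''_j)|^p\big]^{1/p}$ (sums replaced by suprema over $j$ if $p=\infty$). For $0<q\le s\le\infty$ let $s'(q)\in(0,\infty]$ be given by $\frac1{s'(q)}+\frac1s=\frac1q$, and put $\mathfrak{m}^L_{(s;q)}(\sigma,x',x'')=\inf_\tau\|\tau|\ell_{s'(q)}\|\,\|(\sigma/\tau,x',x'')|\ell_s^{L,w}\|$, the infimum over all $\tau=(\tau_j)$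 with $\tau_j\in\mathbb{R}\setminus\{0\}$, where $\sigma/\tau=(\sigma_j/\tau_j)_j$. For $0<q\le s\le\infty$ and $p\ge q$, a Lipschitz map $T:X\to Y$ is Lipschitz $(p,\mathfrak{m}^L(s;q))$-summing if there is $C\ge0$ with $\|(\sigma,Tx',Tx'')|\ell_p\|\le C\,\mathfrak{m}^L_{(s;q)}(\sigma,x',x'')$ for all finite sequences $(\sigma,x',x'')$ in $\mathbb{R}\times X\times X$. $\Pi^L_{(p,\mathfrak{m}^L(s;q))}(X,Y)$ is the class of all such maps. *)

(* Defs.v *)
From HB Require Import structures.
From mathcomp Require Import all_boot all_order all_algebra.
From mathcomp Require Import all_classical all_reals all_analysis.

Set Implicit Arguments.
Unset Strict Implicit.
Unset Printing Implicit Defensive.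

Import Order.TTheory GRing.Theory Num.Theory.
Import numFieldNormedType.Exports.

Local Open Scope classical_set_scope.
Local Open Scope ring_scope.

(* The library's k.-lipschitz is stated for normed modules only, hence the
   definitions below for metric spaces. *)
Definition lipschitz_bound {R : realType} {X Y : metricType R} (f : X -> Y)
    : set R :=
  [set C | 0 <= C /\ forall x y, mdist (f x) (f y) <= C * mdist x y].

Definition lipschitz_maps {R : realType} (X Y : metricType R)
    : set (X -> Y) :=
  [set f | lipschitz_bound f !=set0].
Arguments lipschitz_maps {R} X Y _.

(* Meaningful for f \in lipschitz_maps X Y only: inf set0 is a junk value. *)
Definition Lip {R : realType} {X Y : metricType R} (f : X -> Y) : R :=
  inf (lipschitz_bound f).

(* X^#; the distance of R^o is |y - x|. *)
Definition lipschitz_dual {R : realType} (X : metricType R) (x0 : X)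
    : set (X -> R^o) :=
  [set f | lipschitz_maps X R^o f /\ f x0 = 0].

Definition lipschitz_dual_ball {R : realType} (X : metricType R) (x0 : X)
    : set (X -> R^o) :=
  [set f | lipschitz_dual x0 f /\ Lip f <= 1].

(* The l_p (quasi-)norm of a finite family, for an index 0 < p <= +oo. *)
Definition ell_norm {R : realType} (p : \bar R) (m : nat) (a : 'I_m -> R) : R :=
  match p with
  | r%:E => (\sum_(j < m) `|a j| `^ r) `^ r^-1
  | +oo%E => \big[Num.max/0]_(j < m) `|a j|
  | -oo%E => 0
  end.

(* ||(sigma, x', x'') | l_p|| *)
Definition strong_norm {R : realType} {X : metricType R} (p : \bar R)
    (m : nat) (sigma : 'I_m -> R) (x' x'' : 'I_m -> X) : R :=
  ell_norm p (fun j => `|sigma j| * mdist (x' j) (x'' j)).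

(* ||(sigma, x', x'') | l_p^{L,w}|| *)
Definition weak_norm {R : realType} {X : metricType R} (x0 : X) (p : \bar R)
    (m : nat) (sigma : 'I_m -> R) (x' x'' : 'I_m -> X) : \bar R :=
  ereal_sup [set (ell_norm p
                    (fun j => `|sigma j| * `|f (x' j) - f (x'' j)|))%:E
            | f in lipschitz_dual_ball x0].

(* s'(q), with the extended inverse: +oo^-1 = 0 and 0^-1 = +oo. *)
Definition mixed_index {R : realType} (s q : \bar R) : \bar R :=
  ((q^-1 - s^-1)^-1)%E.

Lemma mixed_indexP {R : realType} (s q : \bar R) :
  (0 < q)%E -> (q <= s)%E ->
  (0 < mixed_index s q)%E /\ ((mixed_index s q)^-1 + s^-1 = q^-1)%E.
Proof.
rewrite /mixed_index inveK => q0 qs.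
have s0 : (0 < s)%E by exact: lt_le_trans qs.
have sfin : (s^-1)%E \is a fin_num.
  by case: s s0 {qs} => [r| |]//; rewrite lte_fin => r0; rewrite inver gt_eqF.
have qfin : (q^-1)%E \is a fin_num.
  by case: q q0 {qs} => [r| |]//; rewrite lte_fin => r0; rewrite inver gt_eqF.
split; last by rewrite subeK.
have le_inv : (s^-1 <= q^-1)%E.
  case: s q s0 q0 qs {sfin qfin} => [r| |] [t| |]//=.
  - rewrite !lte_fin lee_fin => r0 t0 tr.
    by rewrite !inver !gt_eqF// lee_fin lef_pV2.
  - by move=> _ t0 _; rewrite invey inve_ge0 ltW.
rewrite lt_def inve_ge0 sube_ge0 ?sfin ?qfin// le_inv andbT inve_eq0.
by rewrite -(fineK sfin) -(fineK qfin) -EFinB.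
Qed.

(* m^L_{(s;q)}(sigma, x', x'') *)
Definition mixed_norm {R : realType} {X : metricType R} (x0 : X)
    (s q : \bar R) (m : nat) (sigma : 'I_m -> R) (x' x'' : 'I_m -> X)
    : \bar R :=
  ereal_inf [set ((ell_norm (mixed_index s q) tau)%:E *
                  weak_norm x0 s (fun j => sigma j / tau j)%R x' x'')%E
            | tau in [set tau : 'I_m -> R | forall j, tau j != 0]].

(* Pi^L_{(p, m^L(s;q))}(X, Y), for 0 < q <= s <= +oo and q <= p. *)
Definition lipschitz_summing {R : realType} (X Y : metricType R) (x0 : X)
    (p s q : \bar R) : set (X -> Y) :=
  [set T | lipschitz_maps X Y T /\
    exists2 C : R, 0 <= C &
      forall (m : nat) (sigma : 'I_m -> R) (x' x'' : 'I_m -> X),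
        ((strong_norm p sigma (T \o x') (T \o x''))%:E <=
         C%:E * mixed_norm x0 s q sigma x' x'')%E].
Arguments lipschitz_summing {R X} Y x0 p s q _.

(* Main.v *)
Require Import Defs.
From HB Require Import structures.
From mathcomp Require Import all_boot all_order all_algebra.
From mathcomp Require Import all_classical all_reals all_analysis.
From mathcomp Require Import zify ring lra.
(* Imported again so that names such as setP and subsetP refer to finite sets. *)
From mathcomp Require Import fintype finset.

(** Since every entry of [tau] is at most its norm, the mixed norm dominates the
    weak [l_s]-norm ([weak_le_mixed_norm]), and a Lipschitz map multiplies the
    strong norm by at most a Lipschitz constant.  So everything reduces to
    bounding the strong [l_p]-norm of a family in a metric space by a constant
    times its weak [l_s]-norm [W], when [s < p] ([strong_le_weak_norm]).

    The heart of the matter is a weak form of Bourgain's embedding theorem: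
    given [k] pairs of distinct points, there are a 1-Lipschitz function [f] and
    a proportion at least [1 / (18 K)] of the pairs, [K] being of order [log k],
    such that [|f x' - f x''|] is at least [d(x', x'') / (2 K)] on these pairs
    ([lipschitz_separation]).  The function is the distance to a random set of
    points.  For one pair [(a, b)] at distance [d], among the [K] annuli of
    width [d / (2 K)] around [a] and [b] there is one across which the number of
    points less than doubles ([slow_growth]); a random set of the matching
    density meets the inner ball of one point and avoids the outer ball of the
    other with probability at least [1/18] ([card_zeros_hit_miss]).  Averaging
    over the [K] relevant dyadic densities and over the pairs yields [f].

    Testing the weak norm on such an [f], the smallest among [k] of the numbers
    [|sigma_j| d(x'_j, x''_j)] is at most a constant times
    [(log k)^2 k^(-1/s) W] ([weak_norm_min]).  Removing the smallest entry
    repeatedly bounds the sum of the [p]-th powers by [W^p] times a sum of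
    [(log k)^(2p) k^(-p/s)], and this converges because [p > s]. *)

Set Implicit Arguments.
Unset Strict Implicit.
Unset Printing Implicit Defensive.

Import Order.TTheory GRing.Theory Num.Theory.
Import numFieldNormedType.Exports.

Local Open Scope ring_scope.

(** * Random subsets of a finite set *)

(** For [g] uniformly distributed, a random subset of [I] containing each point
    independently with probability [1 / N]; counting functions [g] replaces a
    product measure. *)
Definition zeros (I : finType) (N : nat) (g : {ffun I -> 'I_N}) : {set I} :=
  [set i | g i == 0 :> nat].

Lemma card_zeros_miss (I : finType) (N : nat) (U : {set I}) :
  #|[set g : {ffun I -> 'I_N.+1} | [disjoint U & zeros g]]|
  = (N ^ #|U| * N.+1 ^ #|~: U|)%N.
Proof.
pose F (i : I) : pred 'I_N.+1 := [pred y | (i \in U) ==> (y != ord0)].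
have -> : [set g : {ffun I -> 'I_N.+1} | [disjoint U & zeros g]]
          = [set g in family F].
  apply/setP => g; rewrite !inE disjoint_subset; apply/subsetP/familyP.
    by move=> H i; rewrite /F inE; apply/implyP => /H; rewrite !inE.
  by move=> H i iU; have := H i; rewrite /F !inE iU.
rewrite cardsE card_family foldrE big_map big_enum/=.
rewrite (bigID (mem U))/=; congr (_ * _)%N.
  rewrite -prod_nat_const; apply: eq_bigr => i iU.
  rewrite -[RHS]/(N.+1.-1) -[in RHS](card_ord N.+1) -(cardC1 ord0).
  by apply: eq_card => y; rewrite /F !inE iU.
rewrite -prod_nat_const; apply: eq_big => [i|i iU]; first by rewrite inE.
rewrite -[RHS](card_ord N.+1); apply: eq_card => y.
by rewrite /F !inE (negbTE iU).
Qed.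

Lemma bernoulli_ge (R : realFieldType) (x : R) (u : nat) :
  0 <= x <= 1 -> 1 - u%:R * x <= (1 - x) ^+ u.
Proof.
move=> /andP[x0 x1]; elim: u => [|u IH]; first by rewrite expr0; lra.
rewrite exprS -natr1.
have : (1 - x) * (1 - u%:R * x) <= (1 - x) * (1 - x) ^+ u.
  by rewrite ler_wpM2l// subr_ge0.
have : 0 <= u%:R * x * x by rewrite !mulr_ge0.
nra.
Qed.

Lemma bernoulli_le (R : realFieldType) (x : R) (v : nat) :
  0 <= x <= 1 -> (1 - x) ^+ v * (1 + v%:R * x) <= 1.
Proof.
move=> /andP[x0 x1]; elim: v => [|v IH]; first by rewrite expr0; lra.
apply: le_trans IH.
rewrite exprSr -mulrA ler_wpM2l ?exprn_ge0 ?subr_ge0// -natr1.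
have : 0 <= v%:R * x * x by rewrite !mulr_ge0.
nra.
Qed.

(** The density is [1 / (N + 1)]: when [U] has at most half of [N + 1] elements and [V] at least an eighth, the
    random set avoids [U] with probability at least [1/2], and independently
    meets [V] with probability at least [1/9], by the two Bernoulli bounds. *)
Lemma card_zeros_hit_miss (I : finType) (N : nat) (U V : {set I}) :
  [disjoint U & V] -> (2 * #|U| <= N.+1)%N -> (N.+1 <= 8 * #|V|)%N ->
  (N.+1 ^ #|I| <= 18 * #|[set g : {ffun I -> 'I_N.+1} |
     [disjoint U & zeros g] && ~~ [disjoint V & zeros g]]|)%N.
Proof.
move=> dUV hU hV.
set A := [set g : {ffun I -> 'I_N.+1} | [disjoint U & zeros g]].
set B := [set g : {ffun I -> 'I_N.+1} | [disjoint U :|: V & zeros g]].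
have -> : [set g : {ffun I -> 'I_N.+1} |
     [disjoint U & zeros g] && ~~ [disjoint V & zeros g]] = A :\: B.
  apply/setP => g; rewrite !inE -!setI_eq0 setIUl setU_eq0.
  by case: (_ == _); case: (_ == _).
have BA : B \subset A.
  apply/subsetP => g; rewrite !inE -!setI_eq0 setIUl setU_eq0.
  by case/andP.
rewrite cardsD (setIidPr BA) !card_zeros_miss.
have cUV : #|U :|: V| = (#|U| + #|V|)%N.
  by rewrite cardsU (disjoint_setI0 dUV) cards0 subn0.
have cI : #|I| = (#|U| + #|V| + #|~: (U :|: V)|)%N by rewrite -cUV cardsC.
have cU : #|~: U| = (#|V| + #|~: (U :|: V)|)%N.
  by have := cardsC U; lia.
rewrite cUV cU cI; move: hU hV.
move: #|U| #|V| #|~: (U :|: V)| => u v w hU hV.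
suff : (N.+1 ^ (u + v) <= 18 * (N ^ u * N.+1 ^ v - N ^ (u + v)))%N.
  rewrite -(leq_pmul2r (m := N.+1 ^ w)) ?expn_gt0// -expnD.
  by rewrite -mulnA mulnBl -mulnA -expnD.
clear w cI cU cUV.
rewrite !expnD -mulnBr -(ler_nat rat).
rewrite !natrM natrB; last by case: (v) => // v'; rewrite leq_exp2r.
rewrite !natrX.
have N0 : (0 : rat) < N.+1%:R by rewrite ltr0n.
set x : rat := N.+1%:R^-1.
have x01 : 0 <= x <= 1 by rewrite /x invr_ge0 ler0n invf_le1// ler1n.
have rho : N%:R = N.+1%:R * (1 - x) :> rat.
  by rewrite mulrBr mulr1 mulfV ?gt_eqF// -natr1 addrK.
have H1 := bernoulli_ge u x01; have H2 := bernoulli_le v x01.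
have ux : u%:R * x <= 1 / 2.
  rewrite /x ler_pdivrMr//; have : (2 * u)%:R <= N.+1%:R :> rat by rewrite ler_nat.
  rewrite natrM; lra.
have vx : 1 / 8 <= v%:R * x.
  rewrite /x ler_pdivlMr//; have : N.+1%:R <= (8 * v)%:R :> rat by rewrite ler_nat.
  rewrite natrM; lra.
rewrite rho !exprMn.
set P := (1 - x) ^+ u in H1 *; set Q := (1 - x) ^+ v in H2 *.
set Nu := N.+1%:R ^+ u; set Nv := N.+1%:R ^+ v.
have Nuv : 0 <= Nu * Nv by rewrite mulr_ge0// exprn_ge0// ltW.
have Q0 : 0 <= Q by rewrite exprn_ge0// subr_ge0; case/andP: x01.
have Q9 : Q <= 8 / 9 by nra.
have PQ : 1 <= 18 * (P * (1 - Q)) by nra.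
suff -> : 18 * (Nu * P * (Nv - Nv * Q)) = Nu * Nv * (18 * (P * (1 - Q))).
  by rewrite ler_peMr.
by ring.
Qed.

(** Otherwise [m] at least doubles [K] times, starting from [m 0 >= 1]. *)
Lemma slow_growth (m : nat -> nat) (K : nat) :
  (0 < m 0)%N -> (m K < 2 ^ K)%N -> exists2 i, (i < K)%N & (m i.+1 < 2 * m i)%N.
Proof.
move=> m0 mK; apply: contrapT => H.
suff : (2 ^ K <= m K)%N by rewrite leqNgt mK.
have D i : (i < K)%N -> (2 * m i <= m i.+1)%N.
  by move=> iK; rewrite leqNgt; apply/negP => mi; apply: H; exists i.
have : forall i, (i <= K)%N -> (2 ^ i <= m i)%N; last exact.
elim=> [//|i IH iK]; rewrite expnS; apply: leq_trans (D _ iK).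
by rewrite leq_mul2l IH// ltnW.
Qed.

(** * Separating a pair of points by the distance to a random set *)

Section Frechet.
Variables (R : realType) (X : metricType R) (I : finType) (pts : I -> X).

(** The distance to [A], capped at [M]; the cap gives a value when [A] is
    empty. *)
Definition capped_dist (M : R) (A : {set I}) (x : X) : R :=
  \big[Num.min/M]_(i in A) mdist x (pts i).

Lemma capped_dist_lip (M : R) (A : {set I}) (x y : X) :
  `|capped_dist M A x - capped_dist M A y| <= mdist x y.
Proof.
have half u v : capped_dist M A u - mdist u v <= capped_dist M A v.
  apply/bigmin_geP; split=> [|i iA]; rewrite lerBlDr.
    by rewrite (le_trans (bigmin_le_id _ _ _ _))// lerDl mdist_ge0.
  rewrite (@le_trans _ _ (mdist u (pts i)))//; first exact: bigmin_le_cond.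
  by rewrite addrC metric_triangle.
rewrite ler_norml; have := half x y; have := half y x.
by rewrite (metric_sym y); lra.
Qed.

Lemma capped_dist_le (M r : R) (A : {set I}) (x : X) (i : I) :
  i \in A -> mdist x (pts i) <= r -> capped_dist M A x <= r.
Proof. by move=> iA; apply: le_trans; exact: bigmin_le_cond. Qed.

Lemma capped_dist_ge (M r : R) (A : {set I}) (x : X) :
  r <= M -> (forall i, i \in A -> r <= mdist x (pts i)) ->
  r <= capped_dist M A x.
Proof. by move=> rM rA; apply/bigmin_geP. Qed.

Let cball (r : R) (x : X) : {set I} := [set j | mdist x (pts j) <= r].

(** If the random set meets the ball of radius [r] around [a] and avoids the ball
    of radius [r + e] around [b], then the distance to it is at most [r] at [a]
    and at least [r + e] at [b].  The density that suits the cardinals of these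
    balls is [1 / 2^(t+2)] with [2^t <= u < 2^(t+1)], [u] the cardinal of the
    second ball. *)
Lemma separate_at_scale (M r e : R) (K : nat) (a b : X) :
  (#|I| < 2 ^ K)%N -> 0 < e -> r + e <= M -> r + (r + e) < mdist a b ->
  (0 < #|cball (r + e) b|)%N -> (#|cball (r + e) b| < 2 * #|cball r a|)%N ->
  exists2 t, (t < K)%N &
    ((2 ^ t.+2) ^ #|I| <= 18 * #|[set g : {ffun I -> 'I_(2 ^ t.+2)} |
       (e <= `|capped_dist M (zeros g) a - capped_dist M (zeros g) b|)%R]|)%N.
Proof.
move=> IK e0 rM rd u0 uv.
set U := cball _ b in u0 uv; set V := cball _ a in uv.
have /andP[tu ut] := trunc_log_bounds (ltnSn 1) u0.
set t := trunc_log 2 #|U| in tu ut *; exists t.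
  rewrite -(ltn_exp2l _ _ (ltnSn 1)); apply: leq_ltn_trans tu _.
  exact: leq_ltn_trans (max_card _) IK.
case E : (2 ^ t.+2)%N => [|N]; first by move/eqP: E; rewrite expn_eq0.
rewrite !expnS in E ut.
apply: (@leq_trans (18 * #|[set g : {ffun I -> 'I_N.+1} |
     [disjoint U & zeros g] && ~~ [disjoint V & zeros g]]|)).
  apply: card_zeros_hit_miss; try lia.
  rewrite disjoint_subset; apply/subsetP => i; rewrite !inE => ib.
  rewrite -ltNge; have := metric_triangle a (pts i) b.
  rewrite (metric_sym (pts i) b); lra.
rewrite leq_mul2l/= subset_leq_card//; apply/subsetP => g; rewrite !inE.
rewrite disjoint_subset => /andP[/subsetP Ug /pred0Pn[i /andP[iV ig]]].
have fa : capped_dist M (zeros g) a <= r.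
  by apply: (@capped_dist_le _ _ _ _ i) => //; move: iV; rewrite /= inE.
have fb : r + e <= capped_dist M (zeros g) b.
  apply: capped_dist_ge => // j jg; rewrite leNgt; apply/negP => /ltW jb.
  by have := Ug j; rewrite !inE jb => /(_ isT); rewrite inE in jg; rewrite jg.
rewrite distrC ger0_norm; lra.
Qed.

(** The radii are the multiples of [e = d / (2 K)], so that balls of consecutive
    radii [i e] and [(i + 1) e] with [i < K] around the two points are disjoint.
    Measuring the growth on the smaller of the two cardinals at each radius makes
    [slow_growth] compare the outer ball of one point with the inner ball of
    either point. *)
Lemma random_separation (M : R) (K : nat) (a b : I) :
  (#|I| < 2 ^ K)%N -> pts a != pts b -> mdist (pts a) (pts b) <= M ->
  exists2 t, (t < K)%N &
    ((2 ^ t.+2) ^ #|I| <= 18 * #|[set g : {ffun I -> 'I_(2 ^ t.+2)} |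
       (mdist (pts a) (pts b) <=
        2 * K%:R * `|capped_dist M (zeros g) (pts a)
                      - capped_dist M (zeros g) (pts b)|)%R]|)%N.
Proof.
move=> IK ab dM; set d := mdist _ _ in dM *.
have d0 : 0 < d by rewrite mdist_gt0.
have K0 : (0 < K)%N.
  case: K IK => // /leq_trans/(_ (leqnn _)).
  by rewrite ltnS leqn0 => /eqP/card0_eq/(_ a).
have K0R : (0 : R) < K%:R by rewrite ltr0n.
pose e := d / (2 * K%:R).
have e0 : 0 < e by rewrite divr_gt0// mulr_gt0.
have dE : d = 2 * K%:R * e by rewrite /e; field; rewrite gt_eqF.
pose m i := minn #|cball (i%:R * e) (pts a)| #|cball (i%:R * e) (pts b)|.
have cball_gt0 r c : 0 <= r -> (0 < #|cball r (pts c)|)%N.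
  by move=> r0; apply/card_gt0P; exists c; rewrite inE mdistxx.
have [||i iK mi] := @slow_growth m K.
- by rewrite leq_min !cball_gt0 ?mul0r.
- by apply: leq_ltn_trans IK; rewrite geq_min max_card.
have iKR : i.+1%:R <= K%:R :> R by rewrite ler_nat.
rewrite -natr1 in iKR.
have r0 : 0 <= i%:R * e by rewrite mulr_ge0// ltW.
have rE : i.+1%:R * e = i%:R * e + e by rewrite -natr1 mulrDl mul1r.
have rd : i%:R * e + (i%:R * e + e) < d by rewrite dE; nra.
have rM : i%:R * e + e <= M by lra.
rewrite /m rE in mi.
(* The point whose outer ball is the smaller one plays the role of [b]. *)
have [le_ba|/ltnW le_ab] := leqP #|cball (i%:R * e + e) (pts b)|
                             #|cball (i%:R * e + e) (pts a)|.
  have [||t tK H] := @separate_at_scale M _ e K (pts a) (pts b) IK e0 rM rd.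
  - by rewrite cball_gt0// addr_ge0// ltW.
  - rewrite (minn_idPr le_ba) in mi; apply: leq_trans mi _.
    by rewrite leq_mul2l geq_minl.
  exists t => //; apply: leq_trans H _; rewrite leq_mul2l/= subset_leq_card//.
  by apply/subsetP => g; rewrite !inE => H; rewrite dE ler_wpM2l//.
rewrite /d metric_sym in rd.
have [||t tK H] := @separate_at_scale M _ e K (pts b) (pts a) IK e0 rM rd.
- by rewrite cball_gt0// addr_ge0// ltW.
- rewrite (minn_idPl le_ab) in mi; apply: leq_trans mi _.
  by rewrite leq_mul2l geq_minr.
exists t => //; apply: leq_trans H _; rewrite leq_mul2l/= subset_leq_card//.
by apply/subsetP => g; rewrite !inE distrC => H; rewrite dE ler_wpM2l//.
Qed.

End Frechet.

(** * Many pairs separated by a single Lipschitz function *)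

(** For each pair, one of the [K] densities works with probability at least
    [1/18]; so the expected numbers of separated pairs, summed over the
    densities, amount to at least [#|J| / 18], and some density and some set
    reach [#|J| / (18 K)].  The value of [K] ensures that the [2 #|J|] endpoints
    number less than [2 ^ K]. *)
Lemma lipschitz_separation (R : realType) (X : metricType R) (J : finType)
    (x' x'' : J -> X) (K := (trunc_log 2 #|J|).+2) :
  (forall j, x' j != x'' j) ->
  exists2 f : X -> R, forall x y, `|f x - f y| <= mdist x y &
    (#|J| <= 18 * K * #|[set j |
       (mdist (x' j) (x'' j) <= 2 * K%:R * `|f (x' j) - f (x'' j)|)%R]|)%N.
Proof.
move=> xx; have [J0|Jpos] := posnP #|J|.
  exists (fun=> 0); last by rewrite J0.
  by move=> x y; rewrite subrr normr0 mdist_ge0.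
pose pts (i : bool * J) := if i.1 then x' i.2 else x'' i.2.
pose M := \sum_j mdist (x' j) (x'' j).
pose f t (g : {ffun bool * J -> 'I_(2 ^ t.+2)}) := capped_dist pts M (zeros g).
pose good t (g : {ffun bool * J -> 'I_(2 ^ t.+2)}) j :=
  mdist (x' j) (x'' j) <= 2 * K%:R * `|f t g (x' j) - f t g (x'' j)|.
pose N t : nat := ((2 ^ t.+2) ^ #|{: bool * J}|)%N.
have N0 t : 0 < (N t)%:R :> R by rewrite ltr0n !expn_gt0.
(* The expected number of separated pairs at density [1 / 2^(t+2)]. *)
pose S t : R := \sum_j #|[set g | good t g j]|%:R / (N t)%:R.
have S0 t j : 0 <= #|[set g | good t g j]|%:R / (N t)%:R :> R.
  by rewrite divr_ge0.
have SE t : S t = (\sum_g #|[set j | good t g j]|%:R) / (N t)%:R.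
  rewrite /S -mulr_suml; congr (_ / _).
  under eq_bigr do rewrite cardsE -sum1_card natr_sum big_mkcond.
  under [RHS]eq_bigr do rewrite cardsE -sum1_card natr_sum big_mkcond.
  by rewrite exchange_big.
have SJ : #|J|%:R / 18 <= \sum_(t < K) S t.
  rewrite /S exchange_big/= -sum1_card natr_sum mulr_suml ler_sum// => j _.
  have IK : (#|{: bool * J}| < 2 ^ K)%N.
    by rewrite card_prod card_bool /K expnS ltn_pmul2l// trunc_log_ltn.
  have dM : mdist (x' j) (x'' j) <= M.
    by rewrite /M (bigD1 j)//= lerDl sumr_ge0// => i _; exact: mdist_ge0.
  have [t tK] := @random_separation R X _ pts M K (true, j) (false, j) IK (xx j) dM.
  rewrite -/(N t) => H.
  rewrite (bigD1 (Ordinal tK))//= (@le_trans _ _ (#|[set g | good t g j]|%:R / (N t)%:R))//.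
    by rewrite ler_pdivrMr// mulrAC ler_pdivlMr// mul1r -natrM ler_nat mulnC.
  by rewrite lerDl sumr_ge0.
(* Were the claim false, integrality would bring every count down to at most
   [(#|J| - 1) / (18 K)]. *)
apply: contrapT => nH; suff : \sum_(t < K) S t <= (#|J|%:R - 1) / 18.
  by move: SJ; lra.
rewrite (@le_trans _ _ (\sum_(t < K) (#|J|%:R - 1) / (18 * K%:R)))//; last first.
  rewrite sumr_const card_ord -mulr_natr le_eqVlt; apply/orP; left; apply/eqP.
  by field; rewrite pnatr_eq0.
apply: ler_sum => t _; rewrite SE ler_pdivrMr//.
rewrite (@le_trans _ _ (\sum_(g : {ffun bool * J -> 'I_(2 ^ t.+2)})
                          (#|J|%:R - 1) / (18 * K%:R)))//; last first.
  by rewrite sumr_const card_ffun card_ord -[X in X <= _]mulr_natr.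
apply: ler_sum => g _; rewrite ler_pdivlMr ?mulr_gt0 ?ltr0n//.
rewrite lerBrDr -!natrM natr1 ler_nat ltnNge; apply/negP => H; apply: nH.
exists (f t g); first by move=> x y; exact: capped_dist_lip.
by rewrite mulnC.
Qed.

Lemma lipschitz_separation_in (R : realType) (X : metricType R) (J : finType)
    (A : {set J}) (x' x'' : J -> X) (K := (trunc_log 2 #|A|).+2) :
  (forall j, j \in A -> x' j != x'' j) ->
  exists2 f : X -> R, forall x y, `|f x - f y| <= mdist x y &
    (#|A| <= 18 * K * #|[set j in A |
       (mdist (x' j) (x'' j) <= 2 * K%:R * `|f (x' j) - f (x'' j)|)%R]|)%N.
Proof.
move=> xx; pose u (i : 'I_#|A|) : J := enum_val i.
have [i|f flip H] := @lipschitz_separation R X _ (x' \o u) (x'' \o u).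
  by apply: xx; exact: enum_valP.
exists f => //; rewrite card_ord -/K in H; apply: leq_trans H _.
rewrite leq_mul2l/= -(card_imset _ (@enum_val_inj _ (mem A))) subset_leq_card//.
by apply/subsetP => _ /imsetP[i iB ->]; move: iB; rewrite !inE enum_valP.
Qed.

(** * Summation estimates *)

(** The [2 ^ i] terms with [trunc_log 2 k = i] contribute [(2 rho) ^ i], so
    that a geometric series remains. *)
Lemma sum_trunc_log_le (R : realFieldType) (rho : R) (m : nat) :
  0 <= rho < 1 / 2 ->
  \sum_(k < m) rho ^+ trunc_log 2 k.+1 <= (1 - 2 * rho)^-1.
Proof.
move=> /andP[r0 r2].
have dyadic I : \sum_(1 <= k < 2 ^ I) rho ^+ trunc_log 2 k
                = \sum_(i < I) (2 * rho) ^+ i.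
  elim: I => [|I IH]; first by rewrite big_geq// big_ord0.
  rewrite big_ord_recr/= -IH (@big_cat_nat _ _ _ (2 ^ I))/= ?expn_gt0//; last first.
    by rewrite leq_exp2l.
  congr (_ + _); rewrite big_nat (eq_bigr (fun=> rho ^+ I)); last first.
    by move=> k kI; rewrite (@trunc_log_eq 2 I k).
  rewrite -big_nat sumr_const_nat expnS mul2n -addnn addnK.
  by rewrite exprMn -natrX mulr_natl.
have dyadic_le I : \sum_(i < I) (2 * rho) ^+ i <= (1 - 2 * rho)^-1.
  rewrite -[leRHS]mul1r ler_pdivlMr; last lra.
  have := subrX1 (2 * rho) I.
  have : 0 <= (2 * rho) ^+ I by rewrite exprn_ge0// mulr_ge0.
  lra.
apply: le_trans (dyadic_le m); rewrite -dyadic.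
rewrite -(big_mkord predT (fun k => rho ^+ trunc_log 2 k.+1)) -(big_add1 _ _ 0 m.+1 predT (fun k => rho ^+ trunc_log 2 k)).
rewrite [leRHS](@big_cat_nat _ _ _ m.+1)//=; last exact: ltn_expl.
by rewrite lerDl sumr_ge0// => k _; rewrite exprn_ge0.
Qed.

(** Remove such an entry again and again; the one removed when [k] indices remain
    contributes at most [b k]. *)
Lemma sum_le_of_min (R : realFieldType) (J : finType) (a : J -> R) (b : nat -> R) :
  (forall A : {set J}, A != finset.set0 -> exists2 j, j \in A & a j <= b #|A|) ->
  forall A : {set J}, \sum_(j in A) a j <= \sum_(k < #|A|) b k.+1.
Proof.
move=> H A; move E : #|A| => n; elim: n A E => [|n IH] A AE.
  by rewrite (cards0_eq AE) big_set0 big_ord0.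
have [|j jA aj] := H A; first by rewrite -card_gt0 AE.
rewrite (big_setD1 j)//= big_ord_recr/= addrC -AE lerD//.
by apply: IH; have := cardsD1 j A; rewrite jA AE => -[].
Qed.

(** Polynomial growth is dominated by exponential growth: write
    [gamma ^ (l + 2) = expR ((l + 2) delta) ^ e] and use [x <= expR x],
    with [delta = ln gamma / e]. *)
Lemma powR_le_expr (R : realType) (e gamma : R) : 0 < e -> 1 < gamma ->
  exists2 B : R, 0 < B & forall l : nat, l.+2%:R `^ e <= B * gamma ^+ l.
Proof.
move=> e0 g1; have g0 : 0 < gamma by lra.
pose delta := ln gamma / e.
have d0 : 0 < delta by rewrite divr_gt0// ln_gt0.
exists (gamma ^+ 2 / delta `^ e); first by rewrite divr_gt0 ?exprn_gt0// powR_gt0.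
move=> l; rewrite mulrAC ler_pdivlMr ?powR_gt0// -exprD add2n -powRM//; last exact: ltW.
have -> : gamma ^+ l.+2 = expR (l.+2%:R * delta) `^ e.
  rewrite -powR_mulrn; last exact: ltW.
  rewrite /powR (gt_eqF (expR_gt0 _)) (gt_eqF g0) expRK.
  by congr expR; rewrite /delta; field; rewrite gt_eqF.
apply: ge0_ler_powR; rewrite ?nnegrE ?expR_ge0//; first exact: ltW.
  by rewrite mulr_ge0// ltW.
by apply: le_trans (expR_ge1Dx _); rewrite lerDr.
Qed.

(** * The norms of a finite family *)

Lemma lipschitz_dual_ballP (R : realType) (X : metricType R) (x0 : X)
    (f : X -> R) :
  (forall x y, `|f x - f y| <= mdist x y) ->
  lipschitz_dual_ball x0 (fun x => f x - f x0 : R^o).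
Proof.
move=> flip; set g := fun x => _.
have gb : lipschitz_bound (Y := R^o) g 1.
  split=> // x y; rewrite mul1r; apply: le_trans (flip x y).
  rewrite [leLHS](_ : _ = `|g y - g x|)// distrC /g.
  by rewrite opprB addrA subrK.
split; first by split; [exists 1 | rewrite /g subrr].
by apply: ge_inf gb; exists 0 => C [].
Qed.

Lemma ell_norm_ge0 (R : realType) (p : \bar R) (m : nat) (a : 'I_m -> R) :
  0 <= ell_norm p a.
Proof.
case: p => [r||]//=; first exact: powR_ge0.
by elim/big_ind : _ => // x y x0 y0; rewrite le_max x0.
Qed.

Lemma le_ell_norm (R : realType) (p : \bar R) (m : nat) (a : 'I_m -> R) j :
  (0 < p)%E -> `|a j| <= ell_norm p a.
Proof.
case: p => [r||]//=; last by move=> _; exact: le_bigmax.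
rewrite lte_fin => r0.
rewrite -[leLHS]powRr1// -(mulfV (lt0r_neq0 r0)) powRrM.
apply: ge0_ler_powR; rewrite ?nnegrE ?powR_ge0 ?invr_ge0 ?(ltW r0)//.
  by apply: sumr_ge0 => i _; exact: powR_ge0.
by rewrite (bigD1 j)//= lerDl sumr_ge0// => i _; exact: powR_ge0.
Qed.

Lemma ell_norm_le (R : realType) (p : \bar R) (m : nat) (a b : 'I_m -> R) (L : R) :
  (0 < p)%E -> 0 <= L -> (forall j, `|a j| <= L * `|b j|) ->
  ell_norm p a <= L * ell_norm p b.
Proof.
case: p => [r||]//= r0 L0 ab; last first.
  apply/bigmax_leP; split=> [|j _].
    by rewrite mulr_ge0//; exact: (ell_norm_ge0 +oo%E b).
  by apply: le_trans (ab j) _; rewrite ler_wpM2l// le_bigmax.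
rewrite lte_fin in r0.
rewrite -[X in X * _]powRr1// -(mulfV (lt0r_neq0 r0)) powRrM.
have S0 (c : 'I_m -> R) : 0 <= \sum_j `|c j| `^ r.
  by apply: sumr_ge0 => i _; exact: powR_ge0.
rewrite -powRM ?powR_ge0//.
apply: ge0_ler_powR; rewrite ?nnegrE ?mulr_ge0 ?powR_ge0 ?invr_ge0 ?(ltW r0)//.
rewrite mulr_sumr ler_sum// => j _; rewrite -powRM//.
by apply: ge0_ler_powR; rewrite ?nnegrE ?mulr_ge0// ltW.
Qed.

Lemma weak_norm_ge (R : realType) (X : metricType R) (x0 : X) (p : \bar R)
    (m : nat) (sigma : 'I_m -> R) (x' x'' : 'I_m -> X) (f : X -> R^o) :
  lipschitz_dual_ball x0 f ->
  ((ell_norm p (fun j => `|sigma j| * `|f (x' j) - f (x'' j)|))%:E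
   <= weak_norm x0 p sigma x' x'')%E.
Proof. by move=> fB; apply: ereal_sup_ubound; exists f. Qed.

Lemma weak_norm_ge0 (R : realType) (X : metricType R) (x0 : X) (p : \bar R)
    (m : nat) (sigma : 'I_m -> R) (x' x'' : 'I_m -> X) :
  (0 <= weak_norm x0 p sigma x' x'')%E.
Proof.
have z : forall x y : X, `|(0 : R) - 0| <= mdist x y.
  by move=> x y; rewrite subrr normr0 mdist_ge0.
apply: le_trans (weak_norm_ge _ _ _ _ (lipschitz_dual_ballP x0 z)).
by rewrite lee_fin ell_norm_ge0.
Qed.

(** Every [|tau_j|] is at most the norm of [tau], so multiplying the family
    [sigma / tau] by that norm dominates [sigma] entrywise. *)
Lemma weak_le_mixed_norm (R : realType) (X : metricType R) (x0 : X)
    (s q : \bar R) (m : nat) (sigma : 'I_m -> R) (x' x'' : 'I_m -> X) :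
  (0 < q)%E -> (q <= s)%E ->
  (weak_norm x0 s sigma x' x'' <= mixed_norm x0 s q sigma x' x'')%E.
Proof.
move=> q0 qs; have s0 : (0 < s)%E by exact: lt_le_trans qs.
have [r0 _] := mixed_indexP q0 qs.
apply/ereal_infP => _ [tau tau0 <-]; apply/ereal_supP => _ [f fB <-].
set t := ell_norm _ tau.
apply: (@le_trans _ _ (t * ell_norm s (fun j =>
    `|sigma j / tau j| * `|f (x' j) - f (x'' j)|))%:E).
  rewrite lee_fin; apply: ell_norm_le => //; first exact: ell_norm_ge0.
  move=> j; rewrite !normrM !normr_id mulrA ler_wpM2r//.
  rewrite normrV ?unitfE ?tau0// mulrCA -[leLHS]mulr1 ler_wpM2l//.
  rewrite ler_pdivlMr ?normr_gt0 ?tau0// mul1r.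
  exact: le_ell_norm.
rewrite EFinM lee_wpmul2l//; first by rewrite lee_fin ell_norm_ge0.
exact: weak_norm_ge.
Qed.

(** * Strong norms are controlled by weak norms of smaller index *)

Section WeakBound.
Variables (R : realType) (X : metricType R) (x0 : X) (s : R) (m : nat).
Variables (sigma : 'I_m -> R) (x' x'' : 'I_m -> X) (W : R).
Hypotheses (s1 : 1 <= s)
  (weakW : (weak_norm x0 s%:E sigma x' x'' <= W%:E)%E).

(** Let [alpha] be the smallest of the numbers [|sigma_j| d(x'_j, x''_j)], [j] in
    [A]; assume it positive, so that the pairs consist of distinct points.  The function of [lipschitz_separation_in] gives at least
    [#|A| / (18 (l + 2))] terms of size at least [alpha / (2 (l + 2))] in the weak
    norm; comparing with [W] and using [2 ^ l <= #|A|] yields the bound. *)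
Lemma weak_norm_min (A : {set 'I_m}) (l := trunc_log 2 #|A|) :
  A != finset.set0 ->
  exists2 j, j \in A & `|sigma j| * mdist (x' j) (x'' j)
                       <= 36 * l.+2%:R ^+ 2 * (2 `^ (- s^-1)) ^+ l * W.
Proof.
move=> /set0Pn[i iA]; pose a j := `|sigma j| * mdist (x' j) (x'' j).
have s0 : 0 < s by exact: lt_le_trans s1.
have lipW (f : X -> R) : (forall x y, `|f x - f y| <= mdist x y) ->
    (\sum_j (`|sigma j| * `|f (x' j) - f (x'' j)|) `^ s) `^ s^-1 <= W.
  move=> flip; rewrite -lee_fin; apply: le_trans weakW.
  apply: le_trans (weak_norm_ge _ _ _ _ (lipschitz_dual_ballP x0 flip)).
  rewrite lee_fin le_eqVlt; apply/orP; left; apply/eqP; congr (_ `^ _).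
  apply: eq_bigr => j _; rewrite opprB addrA subrK.
  by rewrite [in RHS]ger0_norm// mulr_ge0.
have W0 : 0 <= W by rewrite -lee_fin (le_trans _ weakW)// weak_norm_ge0.
have b0 : 0 <= 36 * l.+2%:R ^+ 2 * (2 `^ (- s^-1)) ^+ l * W.
  by rewrite !mulr_ge0// exprn_ge0// powR_ge0.
pose j := [arg min_(j < i in A) a j]%O.
have [jA jmin] : j \in A /\ forall k, k \in A -> a j <= a k.
  by rewrite /j; case: arg_minP.
exists j => //; rewrite -/(a j); have [aj0|aj0] := leP (a j) 0.
  exact: le_trans b0.
have xx k : k \in A -> x' k != x'' k.
  move=> kA; rewrite -mdist_gt0 lt_def mdist_ge0 andbT; apply/negP => /eqP kE.
  by have := lt_le_trans aj0 (jmin k kA); rewrite /a kE mulr0 ltxx.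
have [f flip] := lipschitz_separation_in xx; rewrite -/l.
set G := [set k in A | _] => HG.
have K0 : 0 < 2 * l.+2%:R :> R by rewrite mulr_gt0.
pose beta := a j / (2 * l.+2%:R).
have beta0 : 0 < beta by rewrite divr_gt0.
have G_W : #|G|%:R * beta `^ s <= W `^ s.
  have := lipW f flip; set S := \sum_k _ => SW.
  have S0 : 0 <= S by apply: sumr_ge0 => k _; exact: powR_ge0.
  apply: (@le_trans _ _ S); last first.
    rewrite -[leLHS]powRr1// -(mulVf (lt0r_neq0 s0)) powRrM.
    by apply: ge0_ler_powR; rewrite ?nnegrE ?powR_ge0// ltW.
  rewrite /S (bigID (mem G))/= -[leLHS]addr0 lerD//; last first.
    by apply: sumr_ge0 => k _; exact: powR_ge0.
  rewrite mulr_natl -sumr_const ler_sum// => k; rewrite inE => /andP[kA kf].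
  apply: ge0_ler_powR; rewrite ?nnegrE ?(ltW beta0) ?(ltW s0)//.
  rewrite /beta ler_pdivrMr// (le_trans (jmin k kA))// /a -mulrA ler_wpM2l//.
  by rewrite mulrC.
have two_l : 2 ^+ l * beta `^ s <= (18 * l.+2%:R * W) `^ s.
  have K1 : 1 <= 18 * l.+2%:R :> R by rewrite -natrM ler1n.
  apply: le_trans (le1r_powRZ K1 W0 s1).
  have : (2 ^ l)%:R <= (18 * l.+2 * #|G|)%:R :> R.
    rewrite ler_nat (leq_trans _ HG)//.
    by apply: trunc_logP => //; apply/card_gt0P; exists i.
  rewrite natrX !natrM => H.
  apply: (@le_trans _ _ (18 * l.+2%:R * #|G|%:R * beta `^ s)).
    by rewrite ler_wpM2r// powR_ge0.
  by rewrite -!mulrA !ler_wpM2l.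
pose c := 2 `^ s^-1 : R.
have c0 : 0 < c by rewrite powR_gt0.
have cl : (c ^+ l * beta) `^ s <= (18 * l.+2%:R * W) `^ s.
  rewrite powRM ?exprn_ge0 ?(ltW beta0) ?(ltW c0)//.
  suff -> : (c ^+ l) `^ s = 2 ^+ l by [].
  rewrite -(powR_mulrn l (ltW c0)) /c -!powRrM -powR_mulrn//; congr (2 `^ _).
  by field; rewrite gt_eqF.
have clW : c ^+ l * beta <= 18 * l.+2%:R * W.
  rewrite leNgt; apply/negP => lt; move: cl; rewrite leNgt => /negP; apply.
  apply: gt0_ltr_powR => //; rewrite nnegrE; first by rewrite !mulr_ge0.
  by rewrite mulr_ge0 ?exprn_ge0 ?(ltW beta0) ?(ltW c0).
rewrite powRN exprVn mulrAC ler_pdivlMr ?exprn_gt0//.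
have -> : a j = beta * (2 * l.+2%:R) by rewrite /beta divfK ?gt_eqF.
by nra.
Qed.

End WeakBound.

(** For [p = +oo] each entry is bounded by [weak_norm_min] on a singleton, whence
    [36 * 2 ^ 2 = 144].  For finite [p], the powers [theta ^ l] that
    [weak_norm_min] produces have [theta = 2 ^ (- p / s) < 1/2]; this leaves room
    for a ratio [gamma > 1] that absorbs the logarithmic factors while
    [rho = gamma theta] stays below [1/2]. *)
Lemma strong_le_weak_norm (R : realType) (X : metricType R) (x0 : X)
    (p : \bar R) (s : R) : 1 <= s -> (s%:E < p)%E ->
  exists2 C : R, 0 <= C & forall m (sigma : 'I_m -> R) (x' x'' : 'I_m -> X) W,
    (weak_norm x0 s%:E sigma x' x'' <= W%:E)%E ->
    strong_norm p sigma x' x'' <= C * W.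
Proof.
move=> s1; have s0 : 0 < s by exact: lt_le_trans s1.
case: p => [p||]//; last first.
  move=> _; exists 144 => // m sigma x' x'' W H.
  have single j : `|sigma j| * mdist (x' j) (x'' j) <= 144 * W.
    have [|k] := @weak_norm_min _ _ _ _ _ _ _ _ _ s1 H [set j].
      by apply/set0Pn; exists j; rewrite inE.
    rewrite inE => /eqP ->; rewrite cards1 trunc_log1 expr0 mulr1.
    by move=> H1; apply: le_trans H1 _; lra.
  apply/bigmax_leP; split=> [|j _]; last first.
    by rewrite ger0_norm ?mulr_ge0 ?mdist_ge0 ?normr_ge0 ?single.
  by rewrite mulr_ge0// -lee_fin (le_trans _ H)// weak_norm_ge0.
rewrite lte_fin => sp; have p0 : 0 < p by lra.
pose theta : R := (2 `^ (- s^-1)) `^ p.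
have theta0 : 0 < theta by rewrite !powR_gt0.
have theta2 : theta < 1 / 2.
  pose e := (p - s) / s.
  have e0 : 0 < e by rewrite divr_gt0// subr_gt0.
  have pow1 : 1 < 2 `^ e :> R.
    have : 1 `^ e < 2 `^ e :> R by rewrite gt0_ltr_powR// ?nnegrE// ltr1n.
    by rewrite powR1.
  have -> : theta = (2 * 2 `^ e)^-1.
    rewrite /theta -powRrM -{2}(@powRr1 _ 2)// -powRD ?pnatr_eq0 ?implybT//.
    by rewrite -powRN; congr (2 `^ _); rewrite /e; field; rewrite gt_eqF.
  by rewrite div1r ltf_pV2 ?posrE//; lra.
pose gamma := ((2 * theta)^-1 + 1) / 2.
have g1 : 1 < gamma.
  have : 1 < (2 * theta)^-1 by rewrite invf_gt1; lra.
  by rewrite /gamma; lra.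
have [B B0 HB] := @powR_le_expr R (2 * p) gamma (mulr_gt0 (ltr0Sn _ 1) p0) g1.
pose rho := gamma * theta.
have rho2 : 0 <= rho < 1 / 2.
  have -> : rho = (1 / 2 + theta) / 2.
    by rewrite /rho /gamma; field; rewrite gt_eqF.
  by apply/andP; split; lra.
pose D := 36 `^ p * B / (1 - 2 * rho).
have D0 : 0 <= D.
  rewrite /D !mulr_ge0 ?powR_ge0 ?(ltW B0)// invr_ge0.
  by case/andP: rho2; lra.
exists (D `^ p^-1); first exact: powR_ge0.
move=> m sigma x' x'' W H.
have W0 : 0 <= W by rewrite -lee_fin (le_trans _ H)// weak_norm_ge0.
pose a j := `|sigma j| * mdist (x' j) (x'' j).
have a0 j : 0 <= a j by rewrite mulr_ge0 ?mdist_ge0.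
have sumD : \sum_j `|a j| `^ p <= D * W `^ p.
  pose b k := 36 `^ p * B * W `^ p * rho ^+ trunc_log 2 k.
  have amin (A : {set 'I_m}) : A != finset.set0 ->
      exists2 j, j \in A & `|a j| `^ p <= b #|A|.
    move=> A0; have [j jA aj] := weak_norm_min s1 H A0; exists j => //.
    rewrite ger0_norm//; set l := trunc_log 2 _ in aj *.
    have c0 : 0 <= 2 `^ (- s^-1) :> R by exact: powR_ge0.
    apply: (@le_trans _ _ ((36 * l.+2%:R ^+ 2 * 2 `^ (- s^-1) ^+ l * W) `^ p)).
      apply: ge0_ler_powR => //; first exact: ltW.
        by rewrite nnegrE.
      by rewrite nnegrE !mulr_ge0// exprn_ge0.
    rewrite 3?powRM ?mulr_ge0 ?exprn_ge0// /b -/l.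
    have -> : (2 `^ (- s^-1) ^+ l) `^ p = theta ^+ l.
      by rewrite -!powR_mulrn ?powR_ge0// /theta -!powRrM; congr (2 `^ _); ring.
    have -> : (l.+2%:R ^+ 2) `^ p = l.+2%:R `^ (2 * p) :> R.
      by rewrite -powR_mulrn// -powRrM.
    rewrite [leRHS]mulrAC ler_wpM2r ?powR_ge0//.
    rewrite /rho exprMn -!mulrA ler_wpM2l ?powR_ge0// !mulrA ler_wpM2r//.
    by rewrite exprn_ge0// ltW.
  have := sum_le_of_min amin [set: 'I_m]; rewrite (eq_bigl xpredT); last first.
    by move=> j; rewrite inE.
  move/le_trans; apply; rewrite -mulr_sumr /D [leRHS]mulrAC.
  by rewrite ler_wpM2l ?sum_trunc_log_le// !mulr_ge0 ?powR_ge0// ltW.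
rewrite -[X in _ * X]powRr1// -(mulfV (lt0r_neq0 p0)) powRrM.
rewrite -powRM ?powR_ge0//; apply: ge0_ler_powR => //.
- by rewrite invr_ge0 ltW.
- by rewrite nnegrE sumr_ge0// => j _; exact: powR_ge0.
- by rewrite nnegrE mulr_ge0 ?powR_ge0.
Qed.

Lemma lipschitz_maps_summing (R : realType) (X Y : metricType R) (x0 : X)
    (p s q : \bar R) :
  (1 <= s)%E -> (s < p)%E -> (0 < q)%E -> (q <= s)%E ->
  lipschitz_summing Y x0 p s q = lipschitz_maps X Y.
Proof.
move=> s1 sp q0 qs; apply/seteqP; split=> [T []//|T Tlip]; split=> //.
have [L [L0 TL]] := Tlip.
have p0 : (0 < p)%E by rewrite (lt_trans (lt_le_trans q0 qs)).
case: s => [s||] in s1 sp qs *; first last.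
- by [].
- by rewrite ltNge leey in sp.
have [C C0 HC] := @strong_le_weak_norm R X x0 p s s1 sp.
(* The summand 1 makes the constant positive, which matters when the mixed norm
   is infinite. *)
exists (L * C + 1); first by rewrite addr_ge0// mulr_ge0.
move=> m sigma x' x''.
have := weak_le_mixed_norm x0 sigma x' x'' q0 qs.
set M := mixed_norm _ _ _ _ _ _ => wM.
have LC0 : (0 < (L * C + 1)%:E)%E by rewrite lte_fin ltr_wpDl// mulr_ge0.
have M0 : (0 <= M)%E by apply: le_trans wM; exact: weak_norm_ge0.
case E : M => [W||]; rewrite ?E in wM M0 *.
- rewrite -EFinM lee_fin; rewrite lee_fin in M0.
  apply: (@le_trans _ _ (L * strong_norm p sigma x' x'')).
    apply: ell_norm_le => // j; rewrite !normrM !normr_id mulrCA ler_wpM2l//.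
    by rewrite !ger0_norm ?mdist_ge0//; exact: TL.
  rewrite mulrDl -mulrA mul1r (@le_trans _ _ (L * (C * W)))//; last by rewrite lerDl.
  by rewrite ler_wpM2l//; exact: HC wM.
- by rewrite gt0_muley// leey.
- by [].
Qed.

Local Open Scope classical_set_scope.
Local Open Scope ereal_scope.

Theorem mainTheorem2 (R : realType) (X Y : metricType R) (x0 : X) (y0 : Y)
    (p s q : \bar R) (hs : 1 <= s) (hsp : s < p) (hq : 0 < q) (hqs : q <= s) :
  lipschitz_summing Y x0 p s s = lipschitz_maps X Y /\
  lipschitz_maps X Y = lipschitz_summing Y x0 p s q.
Proof.
have s0 : 0 < s by exact: lt_le_trans hqs.
by split; [|apply/esym]; exact: lipschitz_maps_summing.
Qed.
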